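(* Let $r\ge2$, let $\rho_1,\ldots,\rho_r,\sigma_1,\ldots,\sigma_r$ be quantum states on a common space, and let $\varepsilon\ge 0$. (a) If $\frac1r\sum_{i=1}^r d_B(\rho_i,\sigma_i)\le\varepsilon$, then $$\left|F_U(\rho_1,\ldots,\rho_r)-F_U(\sigma_1,\ldots,\sigma_r)\right|\le 2\sqrt2\,\varepsilon .$$ (b) If $\frac1r\sum_{i=1}^r d_H(\rho_i,\sigma_i)\le\varepsilon$, then $$\left|F_H(\rho_1,\ldots,\rho_r)-F_H(\sigma_1,\ldots,\sigma_r)\right|\le 2\sqrt2\,\varepsilon .$$
   Context: A quantum state is a positive semi-definite operator of unit trace on a finite-dimensional complex Hilbert space. Uhlmann fidelity: $F(\rho,\sigma)=\|\sqrt\rho\sqrt\sigma\|_1$ (trace norm). Holevo fidelity: $F_H(\rho,\sigma)=\operatorname{Tr}[\sqrt\rho\sqrt\sigma]$. Bures distance $d_B(\rho,\sigma)=\sqrt{2[1-F(\rho,\sigma)]}$; quantum Hellinger distance $d_H(\rho,\sigma)=\sqrt{2[1-F_H(\rho,\sigma)]}$. Average pairwise Uhlmann and Holevo fidelities: $F_U(\rho_1,\ldots,\rho_r)=\frac{2}{r(r-1)}\sum_{i<j}F(\rho_i,\rho_j)$ and $F_H(\rho_1,\ldots,\rho_r)=\frac{2}{r(r-1)}\sum_{i<j}F_H(\rho_i,\rho_j)$. *)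

(* Defs.v *)
From HB Require Import structures.
From mathcomp Require Import all_boot all_order all_algebra.
From mathcomp Require Import complex reals.

Set Implicit Arguments.
Unset Strict Implicit.
Unset Printing Implicit Defensive.

Import Order.TTheory GRing.Theory Num.Theory.

Local Open Scope ring_scope.
Local Open Scope complex_scope.
Local Open Scope sesquilinear_scope.

(* Operators on the Hilbert space C^n are n x n matrices over R[i], acting on
   column vectors; M ^t* is the adjoint.  The order of R[i] is partial: 0 <= z
   says that z is real and nonnegative. *)
Definition psdmx (R : realType) (n : nat) (A : 'M[R[i]]_n) : Prop :=
  A ^t* = A /\ forall v : 'cV[R[i]]_n, 0 <= (v ^t* *m A *m v) 0 0.

Definition quantum_state (R : realType) (n : nat) (rho : 'M[R[i]]_n) : Prop :=
  psdmx rho /\ \tr rho = 1.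

(* The square root by functional calculus; it is only meaningful for A positive
   semidefinite, see sqrtmx_psd, sqrtmxK and sqrtmx_uniq. *)
Definition sqrtmx (R : realType) (n : nat) (A : 'M[R[i]]_n) : 'M[R[i]]_n :=
  invmx (spectralmx A) *m diag_mx (map_mx sqrtC (spectral_diag A))
    *m spectralmx A.

(* Tr |A| with |A| = sqrt (A^* A); this trace is real and nonnegative, so
   taking its real part loses nothing. *)
Definition trace_norm (R : realType) (n : nat) (A : 'M[R[i]]_n) : R :=
  complex.Re (\tr (sqrtmx (A ^t* *m A))).

Definition fidelity (R : realType) (n : nat) (rho sigma : 'M[R[i]]_n) : R :=
  trace_norm (sqrtmx rho *m sqrtmx sigma).

(* The trace is real for positive semidefinite rho and sigma. *)
Definition holevo_fidelity (R : realType) (n : nat)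
    (rho sigma : 'M[R[i]]_n) : R :=
  complex.Re (\tr (sqrtmx rho *m sqrtmx sigma)).

Definition bures_dist (R : realType) (n : nat) (rho sigma : 'M[R[i]]_n) : R :=
  Num.sqrt (2 * (1 - fidelity rho sigma)).

Definition hellinger_dist (R : realType) (n : nat)
    (rho sigma : 'M[R[i]]_n) : R :=
  Num.sqrt (2 * (1 - holevo_fidelity rho sigma)).

Definition avg_fidelity (R : realType) (n r : nat)
    (rho : 'I_r -> 'M[R[i]]_n) : R :=
  2 / (r%:R * (r%:R - 1)) *
    \sum_(i < r) \sum_(j < r | (i < j)%N) fidelity (rho i) (rho j).

Definition avg_holevo_fidelity (R : realType) (n r : nat)
    (rho : 'I_r -> 'M[R[i]]_n) : R :=
  2 / (r%:R * (r%:R - 1)) *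
    \sum_(i < r) \sum_(j < r | (i < j)%N) holevo_fidelity (rho i) (rho j).

Section SqrtFacts.
Variables (R : realType) (n : nat).
Implicit Types A B P : 'M[R[i]]_n.

Lemma psdmx_spectral A : psdmx A ->
  A = (spectralmx A) ^t* *m diag_mx (spectral_diag A) *m spectralmx A.
Proof.
case=> hA _; have /orthomx_spectralP {1}-> : A \is normalmx.
  by apply/normalmxP; rewrite hA.
by rewrite invmx_unitary ?spectral_unitarymx.
Qed.

Lemma spectral_diag_ge0 A i : psdmx A -> 0 <= spectral_diag A 0 i.
Proof.
move=> pA; have [_ /(_ ((spectralmx A) ^t* *m delta_mx i 0))] := pA.
have /unitarymxP U := spectral_unitarymx A.
rewrite {2}(psdmx_spectral pA) trmx_mul map_mxM trmxCK !mulmxA.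
rewrite -[_ *m spectralmx A *m _]mulmxA U mulmx1.
rewrite -[_ *m spectralmx A *m _]mulmxA U mulmx1.
by rewrite trmx_delta map_delta_mx -rowE -colE !mxE eqxx mulr1n.
Qed.

Lemma psdmx_diag P (d : 'rV[R[i]]_n) : (forall i, 0 <= d 0 i) ->
  psdmx (P ^t* *m diag_mx d *m P).
Proof.
move=> d0; split.
  rewrite !trmx_mul !map_mxM trmxCK mulmxA tr_diag_mx map_diag_mx.
  suff -> : map_mx Num.conj d = d by [].
  by apply/rowP => i; rewrite mxE; apply/CrealP/ger0_real.
move=> v; rewrite !mulmxA -map_mxM -trmx_mul -mulmxA.
rewrite mxE; apply: sumr_ge0 => i _.
by rewrite mul_mx_diag !mxE mulrAC [X in X * _]mulrC mulr_ge0 // mul_conjC_ge0.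
Qed.

Lemma sqrtmx_psd A : psdmx A -> psdmx (sqrtmx A).
Proof.
move=> pA; rewrite /sqrtmx invmx_unitary ?spectral_unitarymx //.
apply: psdmx_diag => i; rewrite mxE sqrtC_ge0.
exact: spectral_diag_ge0.
Qed.

Lemma sqrtmxK A : psdmx A -> sqrtmx A *m sqrtmx A = A.
Proof.
move=> pA; rewrite /sqrtmx !mulmxA mulmxK ?spectral_unit //.
rewrite -[_ *m diag_mx _ *m diag_mx _]mulmxA mulmx_diag.
set d := \row_i _; have -> : d = spectral_diag A.
  by apply/rowP => i; rewrite !mxE -expr2 sqrtCK.
by rewrite invmx_unitary ?spectral_unitarymx // -psdmx_spectral.
Qed.

Lemma sqrtmx_uniq A B : psdmx A -> psdmx B -> B *m B = A -> B = sqrtmx A.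
Proof.
move=> pA pB eBA.
have UA := spectral_unitarymx A; have UB := spectral_unitarymx B.
have uA := spectral_unit A; have uB := spectral_unit B.
rewrite /sqrtmx; set P := spectralmx A in UA uA *.
have eB := psdmx_spectral pB; rewrite -invmx_unitary // in eB.
set Q := spectralmx B in UB uB eB *; set e := spectral_diag B in eB.
have eA := psdmx_spectral pA; rewrite -invmx_unitary // -/P in eA.
set d := spectral_diag A in eA *.
have [W eW] : {W | W = P *m invmx Q} by exists (P *m invmx Q).
have WE : W *m diag_mx e *m diag_mx e = diag_mx d *m W.
  have : P *m A *m invmx Q = P *m (B *m B) *m invmx Q by rewrite eBA.
  by rewrite {1}eA eB eW !mulmxA mulmxV // mul1mx mulmxK // mulmxK // => ->.
have WS : W *m diag_mx e = diag_mx (map_mx sqrtC d) *m W.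
  apply/matrixP => i j; move/matrixP/(_ i j): WE.
  rewrite !(mul_mx_diag, mul_diag_mx) !mxE.
  have [->|w0] := eqVneq (W i j) 0; first by move=> _; rewrite !mul0r mulr0.
  rewrite -mulrA [RHS]mulrC => /(mulfI w0) <-.
  by rewrite -expr2 sqrCK ?spectral_diag_ge0 // mulrC.
rewrite {1}eB; apply: (can_inj (mulKmx uA)); rewrite !mulmxA -eW WS.
by rewrite eW !mulmxA mulmxV // mul1mx mulmxKV.
Qed.

End SqrtFacts.

(* Main.v *)
(* Writing the trace norm as the maximum of Re tr (A K) over contractions K
   (attained at the adjoint of the partial isometry of the polar decomposition)
   makes the fidelity a supremum of Frobenius inner products.  If K is optimal
   for (rho, sigma), then sqrt rho and sqrt sigma K are at Frobenius distance at
   most d_B(rho, sigma), so Cauchy-Schwarz makes the fidelity 1-Lipschitz in each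
   argument for d_B; the Holevo fidelity is the case K = 1.  Each index occurs
   in r - 1 pairs, and averaging gives the bound with constant 2, which is
   better than 2 sqrt 2. *)
Require Import Defs.
From HB Require Import structures.
From mathcomp Require Import all_boot all_order all_algebra.
From mathcomp Require Import complex reals.
From mathcomp Require Import ring lra.

Set Implicit Arguments.
Unset Strict Implicit.
Unset Printing Implicit Defensive.

Import Order.TTheory GRing.Theory Num.Theory.

Local Open Scope ring_scope.
Local Open Scope complex_scope.

Section Frobenius.
Local Open Scope sesquilinear_scope.
Variables (R : realType) (n : nat).
Implicit Types A B K S T U X Y Z : 'M[R[i]]_n.

(** * Adjoints, Gram matrices and the pseudo-inverse *)

Lemma adjmxM A B : (A *m B) ^t* = B ^t* *m A ^t*.
Proof. by rewrite trmx_mul map_mxM. Qed.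

Lemma psdmx_gram A : psdmx (A ^t* *m A).
Proof.
split=> [|v]; first by rewrite adjmxM trmxCK.
rewrite mulmxA -mulmxA -map_mxM -trmx_mul mxE.
by apply: sumr_ge0 => i _; rewrite !mxE mulrC mul_conjC_ge0.
Qed.

(* The inverses of the eigenvalues use the convention 0^-1 = 0. *)
Lemma psdmx_pinv A : psdmx A ->
  exists B, [/\ B ^t* = B, B *m A = A *m B, B *m A *m B = B & A *m B *m A = A].
Proof.
move=> pA; have /unitarymxP := spectral_unitarymx A.
move: (psdmx_spectral pA) (fun i => spectral_diag_ge0 i pA).
move: (spectralmx A) (spectral_diag A) => Q d -> d0 U.
have [S SE SM] : exists2 S : 'M[R[i]]_n -> 'M[R[i]]_n,
    (forall D, S D = Q ^t* *m D *m Q) & forall D E, S D *m S E = S (D *m E).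
  exists (fun D => Q ^t* *m D *m Q) => // D E.
  by rewrite !mulmxA -[_ *m Q *m Q ^t*]mulmxA U mulmx1.
pose e : 'rV_n := map_mx GRing.inv d.
have mulVV (x : R[i]) : x * x^-1 * x = x.
  by have [->|x0] := eqVneq x 0; rewrite ?mulr0 // mulfV // mul1r.
rewrite -SE; exists (S (diag_mx e)); rewrite !SM !mulmx_diag; split.
- by rewrite SE; apply: (psdmx_diag _ _).1 => i; rewrite mxE invr_ge0 d0.
- by congr (S (diag_mx _)); apply/rowP => i; rewrite !mxE mulrC.
- congr (S (diag_mx _)); apply/rowP => i.
  by rewrite !mxE -{2}[d _ _]invrK mulVV.
- by congr (S (diag_mx _)); apply/rowP => i; rewrite !mxE mulVV.
Qed.

(** * The real Frobenius inner product *)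

Definition frob X Y : R := complex.Re (\tr (X ^t* *m Y)).

Lemma Re_mxtrace_adj A : complex.Re (\tr (A ^t*)) = complex.Re (\tr A).
Proof.
rewrite trace_map_mx mxtrace_tr.
by case: (\tr A).
Qed.

(** This symmetry is what the real part in [frob] buys: the complex trace form is only Hermitian. *)
Lemma frobC X Y : frob X Y = frob Y X.
Proof. by rewrite /frob -Re_mxtrace_adj adjmxM trmxCK. Qed.

Lemma frobDr X Y Z : frob X (Y + Z) = frob X Y + frob X Z.
Proof. by rewrite /frob mulmxDr !raddfD. Qed.

Lemma frobNr X Y : frob X (- Y) = - frob X Y.
Proof. by rewrite /frob mulmxN !raddfN. Qed.

Lemma frobBr X Y Z : frob X (Y - Z) = frob X Y - frob X Z.
Proof. by rewrite frobDr frobNr. Qed.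

Lemma frobBl X Y Z : frob (X - Y) Z = frob X Z - frob Y Z.
Proof. by rewrite frobC frobBr !(frobC Z). Qed.

Lemma frobZr (a : R) X Y : frob X (a%:C *: Y) = a * frob X Y.
Proof.
rewrite /frob -scalemxAr mxtraceZ; case: (\tr _) => x y /=.
by rewrite mul0r subr0.
Qed.

Lemma frob_adj X Y : frob (X ^t*) (Y ^t*) = frob X Y.
Proof. by rewrite frobC /frob trmxCK mxtrace_mulC. Qed.

Lemma mxtrace_frob_ge0 X : 0 <= \tr (X ^t* *m X).
Proof.
apply: sumr_ge0 => i _; rewrite mxE; apply: sumr_ge0 => j _.
by rewrite !mxE mulrC mul_conjC_ge0.
Qed.

Lemma frob_ge0 X : 0 <= frob X X.
Proof. by move: (mxtrace_frob_ge0 X); rewrite lecE => /andP[]. Qed.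

Lemma frob_eq0 X : frob X X = 0 -> X = 0.
Proof.
(* The trace is nonnegative in [R[i]], hence real, so it vanishes together with its real part. It is
   the sum of all squared moduli of entries, each of which must then be zero. *)
move=> X0; have tr0 : \tr (X ^t* *m X) = 0.
  move: (mxtrace_frob_ge0 X) X0; rewrite /frob; case: (\tr _) => x y /=.
  by rewrite lecE /= => /andP[/eqP-> _] ->.
apply/matrixP => i j; rewrite [RHS]mxE; apply/eqP.
rewrite -mul_conjC_eq0; apply/eqP; move: i.
have row_ge0 k l : true -> 0 <= X k l * (X k l)^* by rewrite mul_conjC_ge0.
suff : \sum_k X k j * (X k j)^* = 0.
  by move=> s0 i; apply: (psumr_eq0P (row_ge0^~ j) s0).
apply: (@psumr_eq0P _ _ predT (fun j => \sum_k X k j * (X k j)^*)) => //.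
  by move=> l _; apply: sumr_ge0 => k _; apply: row_ge0.
rewrite -[RHS]tr0; apply: eq_bigr => l _; rewrite mxE.
by apply: eq_bigr => k _; rewrite !mxE mulrC.
Qed.

Lemma frob_CauchySchwarz X Y : frob X Y <= Num.sqrt (frob X X * frob Y Y).
Proof.
apply: le_trans (ler_norm _) _; rewrite -sqrtr_sqr ler_sqrt; last first.
  by rewrite mulr_ge0 ?frob_ge0.
have [/frob_eq0 -> | Y0] := eqVneq (frob Y Y) 0.
  by rewrite /frob !mulmx0 raddf0 /= expr0n mulr0.
have Yp : 0 < frob Y Y by rewrite lt_def Y0 frob_ge0.
(* The residual of the orthogonal projection of [X] onto the line of [Y] has nonnegative squared
   norm. *)
have := frob_ge0 (X - (frob X Y / frob Y Y)%:C *: Y).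
rewrite frobBr frobZr !frobBl ![frob (_ *: _) _]frobC !frobZr.
move: Y0 Yp; move: (frob X X) (frob X Y) (frob Y Y) => a b c Y0 Yp.
have -> : a - b / c * b - b / c * (b - b / c * c) = (a * c - b ^+ 2) / c.
  by field.
by rewrite pmulr_lge0 ?invr_gt0 // subr_ge0.
Qed.

(** * Contractions: operator norm at most 1, expressed through [frob] alone *)

Definition contraction K : Prop :=
  (forall X, frob (K *m X) (K *m X) <= frob X X) /\
  (forall X, frob (X *m K) (X *m K) <= frob X X).

Lemma contraction1 : contraction 1%:M.
Proof. by split=> X; rewrite ?mul1mx ?mulmx1. Qed.

Lemma contractionM K L : contraction K -> contraction L -> contraction (K *m L).
Proof.
case=> Kl Kr [Ll Lr]; split=> X.
  by rewrite -mulmxA (le_trans (Kl _)).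
by rewrite mulmxA (le_trans (Lr _)).
Qed.

Lemma contraction_adj K : contraction K -> contraction (K ^t*).
Proof.
by case=> Kl Kr; split=> X; rewrite -frob_adj adjmxM trmxCK -[leRHS]frob_adj.
Qed.

(* K^* K is a projection, so ||X||^2 = ||K^* K X||^2 + ||X - K^* K X||^2. *)
Lemma partial_isometry_mulmx K X :
  K *m K ^t* *m K = K -> frob (K *m X) (K *m X) <= frob X X.
Proof.
move=> KKK; set P := K ^t* *m K.
have fKX : frob (K *m X) (K *m X) = frob X (P *m X).
  by rewrite /frob adjmxM !mulmxA.
have hP : P ^t* = P by rewrite adjmxM trmxCK.
have PP : P *m P = P by rewrite /P -mulmxA (mulmxA K) KKK.
move: P fKX hP PP => P fKX hP PP.
have fPX : frob (P *m X) (P *m X) = frob X (P *m X).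
  by rewrite /frob adjmxM hP -mulmxA [P *m (P *m _)]mulmxA PP.
rewrite fKX; have := frob_ge0 (X - P *m X).
by rewrite frobBr !frobBl fPX (frobC _ X) subrr subr0 subr_ge0.
Qed.

Lemma partial_isometry_contraction K :
  K *m K ^t* *m K = K -> contraction K.
Proof.
move=> KKK; split=> X; first exact: partial_isometry_mulmx.
rewrite -frob_adj -[leRHS]frob_adj adjmxM; apply: partial_isometry_mulmx.
(* The adjoint of a partial isometry is again one: take adjoints in [KKK]. *)
by rewrite trmxCK -[RHS](congr1 (fun A => A ^t*) KKK) !adjmxM trmxCK mulmxA.
Qed.

(** * Polar decomposition and duality for the trace norm *)

Lemma polar_decomposition A : let P := sqrtmx (A ^t* *m A) in
  exists W, [/\ contraction W, W *m P = A & W ^t* *m A = P].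
Proof.
move=> P; have pG := psdmx_gram A; have pP : psdmx P by apply: sqrtmx_psd.
have PP : P *m P = A ^t* *m A by apply: sqrtmxK.
move: P pP PP => P pP PP.
have [V [hV VP VPV PVP]] := psdmx_pinv pP.
have hP := pP.1.
have VPP : V *m (P *m P) = P by rewrite mulmxA VP.
have WA : (A *m V) ^t* *m A = P by rewrite adjmxM hV -mulmxA -PP.
(* [V] is the pseudo-inverse of [P], so [A *m V] plays the role of A |A|^-1 and is a partial
   isometry even when [A] is singular. *)
exists (A *m V); split=> //.
  apply: partial_isometry_contraction.
  rewrite -mulmxA [_ ^t* *m _]mulmxA WA.
  by rewrite -[A *m V *m _]mulmxA [V *m (_ *m _)]mulmxA VPV.
(* Since A^* A = P^2, the matrices [A] and [P] have the same kernel; as [P] annihilates V P - 1, the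
   Frobenius norm of A (V P - 1) is zero. *)
apply/subr0_eq/frob_eq0.
rewrite /frob; have -> : A *m V *m P - A = A *m (V *m P - 1%:M).
  by rewrite mulmxBr mulmx1 mulmxA.
have P0 : P *m (V *m P - 1%:M) = 0.
  by rewrite mulmxBr mulmx1 mulmxA PVP subrr.
by rewrite adjmxM -mulmxA [A ^t* *m _]mulmxA -PP -mulmxA P0 !mulmx0 raddf0.
Qed.

Lemma trace_norm_attained A :
  exists2 K, contraction K & trace_norm A = complex.Re (\tr (A *m K)).
Proof.
have [W [cW _ WA]] := polar_decomposition A.
exists (W ^t*); first exact: contraction_adj.
by rewrite mxtrace_mulC WA.
Qed.

(* With A = W P, this is Cauchy-Schwarz for sqrt P and K W sqrt P. *)
Lemma Re_mxtrace_le_trace_norm A K :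
  contraction K -> complex.Re (\tr (A *m K)) <= trace_norm A.
Proof.
move=> cK; have [W [cW WP _]] := polar_decomposition A.
rewrite /trace_norm; move: WP; set P := sqrtmx _ => WP.
have pP : psdmx P by apply/sqrtmx_psd/psdmx_gram.
have SS := sqrtmxK pP; have [hS _] := sqrtmx_psd pP.
move: P pP (sqrtmx P) WP SS hS => P _ S WP SS hS.
have fS : frob S S = complex.Re (\tr P) by rewrite /frob hS SS.
have -> : complex.Re (\tr (A *m K)) = frob S (K *m W *m S).
  rewrite /frob hS -WP -SS [in LHS]mxtrace_mulC [in RHS]mxtrace_mulC.
  by rewrite !mulmxA.
apply: le_trans (frob_CauchySchwarz _ _) _.
rewrite -fS -[leRHS]ger0_norm ?frob_ge0 // -sqrtr_sqr expr2.
rewrite ler_wsqrtr // ler_wpM2l ?frob_ge0 //.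
exact: (contractionM cK cW).1.
Qed.

(** If [K] is optimal for [A], its adjoint is a competitor for the adjoint of [A] with the same real
    trace. Applied twice, this yields equality and hence the symmetry of the fidelity. *)
Lemma trace_norm_adj_le A : trace_norm A <= trace_norm (A ^t*).
Proof.
have [K cK ->] := trace_norm_attained A.
rewrite -Re_mxtrace_adj adjmxM mxtrace_mulC.
exact/Re_mxtrace_le_trace_norm/contraction_adj.
Qed.

Lemma trace_norm_adj A : trace_norm (A ^t*) = trace_norm A.
Proof.
apply/le_anti/andP; split; last exact: trace_norm_adj_le.
by have := trace_norm_adj_le (A ^t*); rewrite trmxCK.
Qed.

Lemma trace_norm_hermC S T : S ^t* = S -> T ^t* = T ->
  trace_norm (S *m T) = trace_norm (T *m S).
Proof.
by move=> hS hT; have := trace_norm_adj (T *m S); rewrite adjmxM hS hT => ->.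
Qed.

(** * Lipschitz bounds for matrices of Frobenius norm 1 *)

Lemma frob_subM_le S T K : frob S S = 1 -> frob T T = 1 -> contraction K ->
  frob (S - T *m K) (S - T *m K) <= 2 * (1 - frob S (T *m K)).
Proof.
(* Expand the square: |S|^2 = 1 and |T K|^2 <= 1. For [K] optimal the bound is the squared Bures
   distance. *)
move=> S1 T1 [_ /(_ T)]; move: (T *m K) => Y; rewrite T1.
by rewrite frobBr !frobBl (frobC Y S) S1; lra.
Qed.

Lemma frobM_le U Y K : frob U U = 1 -> contraction K ->
  frob U (Y *m K) <= Num.sqrt (frob Y Y).
Proof.
move=> U1 [_ /(_ Y) le_YK]; apply: le_trans (frob_CauchySchwarz _ _) _.
by rewrite U1 mul1r ler_wsqrtr.
Qed.

Lemma trace_norm_herm_attained S T : S ^t* = S ->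
  exists2 K, contraction K & trace_norm (S *m T) = frob S (T *m K).
Proof.
move=> hS; have [K cK ->] := trace_norm_attained (S *m T).
by exists K => //; rewrite /frob hS mulmxA.
Qed.

Lemma frob_le_trace_norm S T K : S ^t* = S -> contraction K ->
  frob S (T *m K) <= trace_norm (S *m T).
Proof.
move=> hS cK; have := Re_mxtrace_le_trace_norm (S *m T) cK.
by rewrite /frob hS mulmxA.
Qed.

(** With [V] optimal for (U, S) and [K] optimal for (S, T), split S V = T K V + (S - T K) V. The
    first term is bounded by duality, because K V is a contraction; the second by Cauchy-Schwarz. *)
Lemma trace_norm_lipschitz U S T : U ^t* = U -> S ^t* = S ->
  frob U U = 1 -> frob S S = 1 -> frob T T = 1 ->
  trace_norm (U *m S) <=
    trace_norm (U *m T) + Num.sqrt (2 * (1 - trace_norm (S *m T))).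
Proof.
move=> hU hS U1 S1 T1.
have [V cV ->] := trace_norm_herm_attained S hU.
have [K cK ->] := trace_norm_herm_attained T hS.
have le_UT := frob_le_trace_norm T hU (contractionM cK cV).
rewrite mulmxA in le_UT.
have le_U := frobM_le (S - T *m K) U1 cV.
rewrite mulmxBl frobBr in le_U.
have le_ST := ler_wsqrtr (frob_subM_le S1 T1 cK).
lra.
Qed.

Lemma frob_lipschitz U S T : frob U U = 1 -> frob S S = 1 -> frob T T = 1 ->
  frob U S <= frob U T + Num.sqrt (2 * (1 - frob S T)).
Proof.
move=> U1 S1 T1; rewrite -lerBlDl -frobBr -[S - T]mulmx1.
apply: le_trans (frobM_le _ U1 contraction1) _; apply: ler_wsqrtr.
by have := frob_subM_le S1 T1 contraction1; rewrite mulmx1.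
Qed.

End Frobenius.

(** Pass from [f x x'] to [f y y'] through [f x y'], changing one argument at a time; symmetry
    brings the changing argument into second position. The two directions use four instances of the
    one-sided bound. *)
Lemma two_sided_lipschitz (R : realDomainType) (T : Type) (P : T -> Prop)
    (f d : T -> T -> R) :
  (forall x y, P x -> P y -> f x y = f y x) ->
  (forall x y, P x -> P y -> d x y = d y x) ->
  (forall z x y, P z -> P x -> P y -> f z x <= f z y + d x y) ->
  forall x x' y y', P x -> P x' -> P y -> P y' ->
    `| f x x' - f y y' | <= d x y + d x' y'.
Proof.
move=> fC dC lip x x' y y' Px Px' Py Py'; rewrite ler_norml.
have := lip x x' y' Px Px' Py'; have := lip x y' x' Px Py' Px'.
have := lip y' x y Py' Px Py; have := lip y' y x Py' Py Px.
rewrite (fC y' x) // (fC y' y) // (dC y x) // (dC y' x') //.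
by move=> *; apply/andP; split; lra.
Qed.

(** * Both fidelities of quantum states, via their square roots *)

Section States.
Local Open Scope sesquilinear_scope.
Variables (R : realType) (n : nat).
Implicit Types (rho sigma tau : 'M[R[i]]_n).

Lemma sqrtmx_herm rho : quantum_state rho -> (sqrtmx rho) ^t* = sqrtmx rho.
Proof. by case=> /sqrtmx_psd[]. Qed.

(** Unit trace enters the proof here, as the normalization that the Lipschitz bounds require. *)
Lemma frob_sqrtmx rho : quantum_state rho ->
  frob (sqrtmx rho) (sqrtmx rho) = 1.
Proof.
by move=> q; rewrite /frob (sqrtmx_herm q) (sqrtmxK q.1) q.2.
Qed.

Lemma fidelityC rho sigma : quantum_state rho -> quantum_state sigma ->
  fidelity rho sigma = fidelity sigma rho.
Proof.
by move=> /sqrtmx_herm hr /sqrtmx_herm hs; exact: trace_norm_hermC hr hs.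
Qed.

Lemma holevo_fidelityC rho sigma :
  holevo_fidelity rho sigma = holevo_fidelity sigma rho.
Proof.
exact: congr1 (mxtrace_mulC (sqrtmx rho) (sqrtmx sigma)).
Qed.

Lemma holevo_fidelity_frob rho sigma : quantum_state rho ->
  holevo_fidelity rho sigma = frob (sqrtmx rho) (sqrtmx sigma).
Proof. by move=> q; rewrite /frob (sqrtmx_herm q). Qed.

Lemma fidelity_dist_le rho rho' sigma sigma' :
  quantum_state rho -> quantum_state rho' ->
  quantum_state sigma -> quantum_state sigma' ->
  `| fidelity rho rho' - fidelity sigma sigma' |
    <= bures_dist rho sigma + bures_dist rho' sigma'.
Proof.
apply: (@two_sided_lipschitz _ _ (@quantum_state R n)) => [x y|x y|z x y].
- exact: fidelityC.
- by move=> qx qy; rewrite /bures_dist (fidelityC qx qy).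
- move=> qz qx qy; apply: trace_norm_lipschitz; try exact: sqrtmx_herm.
  all: exact: frob_sqrtmx.
Qed.

Lemma holevo_fidelity_dist_le rho rho' sigma sigma' :
  quantum_state rho -> quantum_state rho' ->
  quantum_state sigma -> quantum_state sigma' ->
  `| holevo_fidelity rho rho' - holevo_fidelity sigma sigma' |
    <= hellinger_dist rho sigma + hellinger_dist rho' sigma'.
Proof.
apply: (@two_sided_lipschitz _ _ (@quantum_state R n)) => [x y|x y|z x y].
- by move=> _ _; exact: holevo_fidelityC.
- by move=> _ _; rewrite /hellinger_dist (holevo_fidelityC x y).
- move=> qz qx qy; rewrite /hellinger_dist.
  rewrite (holevo_fidelity_frob x qz) (holevo_fidelity_frob y qz).
  rewrite (holevo_fidelity_frob y qx).
  exact: frob_lipschitz (frob_sqrtmx qz) (frob_sqrtmx qx) (frob_sqrtmx qy).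
Qed.

End States.

(** * Averaging over pairs *)

Lemma sum_pairs_add (R : pzRingType) (r : nat) (d : 'I_r -> R) :
  \sum_(i < r) \sum_(j < r | (i < j)%N) (d i + d j)
  = (r%:R - 1) * \sum_(i < r) d i.
Proof.
under eq_bigr do rewrite big_split /=.
(* Exchanging the sums of the [d j] half leaves, for each [i], one copy of [d i] per index above [i]
   and one per index below. *)
rewrite big_split /= [X in _ + X](exchange_big_dep predT) //= -big_split mulr_sumr.
apply: eq_bigr => i _ /=; rewrite mulrBl mul1r mulr_natl.
(* The right side becomes the sum of [d i] over all indices other than [i]. *)
rewrite -[X in d i *+ X]card_ord -sumr_const [X in _ = X - _](bigD1 i) //=.
rewrite [d i + _]addrC addrK.
rewrite [RHS](bigID (fun j : 'I_r => (i < j)%N)) /=.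
by congr (_ + _); apply: eq_bigl => j; rewrite -(inj_eq val_inj) /=; case: ltngtP.
Qed.

Lemma avg_pairs_dist_le (R : realType) (r : nat) (f g : 'I_r -> 'I_r -> R)
    (d : 'I_r -> R) :
  (2 <= r)%N -> (forall i j, `| f i j - g i j | <= d i + d j) ->
  `| 2 / (r%:R * (r%:R - 1)) * (\sum_(i < r) \sum_(j < r | (i < j)%N) f i j)
     - 2 / (r%:R * (r%:R - 1)) * (\sum_(i < r) \sum_(j < r | (i < j)%N) g i j) |
  <= 2 * (r%:R^-1 * \sum_(i < r) d i).
Proof.
move=> r2 fg; have r1 : 0 < (r%:R - 1 : R) by rewrite subr_gt0 ltr1n.
have r0 : 0 < (r%:R : R) by rewrite ltr0n (leq_trans _ r2).
(* The constant 2 arises here: the r - 1 occurrences of each index cancel that factor of the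
   normalization, nonzero as r >= 2. *)
have -> : 2 * (r%:R^-1 * \sum_(i < r) d i)
  = 2 / (r%:R * (r%:R - 1)) * ((r%:R - 1) * \sum_(i < r) d i).
  by field; rewrite !gt_eqF.
rewrite -mulrBr normrM ger0_norm; last by rewrite divr_ge0 ?mulr_ge0 ?ltW.
apply: ler_wpM2l; first by rewrite divr_ge0 ?mulr_ge0 ?ltW.
rewrite -sum_pairs_add -sumrB; apply: le_trans (ler_norm_sum _ _ _) _.
apply: ler_sum => i _; rewrite -sumrB; apply: le_trans (ler_norm_sum _ _ _) _.
by apply: ler_sum => j _; apply: fg.
Qed.

Theorem mainTheorem5 (R : realType) (n r : nat)
    (rho sigma : 'I_r -> 'M[R[i]]_n) (eps : R)
    (hr : (2 <= r)%N)
    (hrho : forall i : 'I_r, quantum_state (rho i))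
    (hsigma : forall i : 'I_r, quantum_state (sigma i))
    (heps : 0 <= eps) :
  (r%:R^-1 * \sum_(i < r) bures_dist (rho i) (sigma i) <= eps ->
   `| avg_fidelity rho - avg_fidelity sigma | <= 2 * Num.sqrt 2 * eps) /\
  (r%:R^-1 * \sum_(i < r) hellinger_dist (rho i) (sigma i) <= eps ->
   `| avg_holevo_fidelity rho - avg_holevo_fidelity sigma |
     <= 2 * Num.sqrt 2 * eps).
Proof.
have s2 : 1 <= Num.sqrt 2 :> R by rewrite -[leLHS]sqrtr1 ler_wsqrtr ?ler1n.
(* Nonnegativity of [eps] lets the constant 2 be relaxed to the stated one. *)
have eps2 : 2 * eps <= 2 * Num.sqrt 2 * eps by rewrite ler_wpM2r // ler_peMr.
split=> hd; apply: le_trans _ eps2.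
  apply: le_trans (avg_pairs_dist_le hr
    (d := fun i => bures_dist (rho i) (sigma i)) _) _.
    by move=> i j; apply: fidelity_dist_le.
  by rewrite ler_pM2l.
apply: le_trans (avg_pairs_dist_le hr
  (d := fun i => hellinger_dist (rho i) (sigma i)) _) _.
  by move=> i j; apply: holevo_fidelity_dist_le.
by rewrite ler_pM2l.
Qed.
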